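(* Let $\Gamma$ be a group and $M$ a conical refinement $\Gamma$-monoid. Then $\operatorname{RegSpec}_\Gamma(M)$ is homeomorphic to $\mathscr{PF}il_r(M)$.
   Context: All monoids are commutative, written additively. The algebraic preorder on $M$ is: $x\le y$ iff $y=x+z$ for some $z\in M$; write $x\parallel y$ if $x\nleq y$ and $y\nleq x$. $M$ is conical if $x+y=0$ implies $x=y=0$; it is a refinement monoid if whenever $a+b=c+d$ there are $z_1,\dots,z_4\in M$ with $a=z_1+z_2$, $b=z_3+z_4$, $c=z_1+z_3$, $d=z_2+z_4$. A $\Gamma$-monoid is a monoid with an action of the group $\Gamma$ by monoid automorphisms, written ${}^\gamma x$; $\mathbb N[\Gamma]$ acts by ${}^{(\sum n_i\gamma_i)}x=\sum n_i\,{}^{\gamma_i}x$. A $\Gamma$-order ideal is a submonoid that is a down-set for $\le$ and closed under $\Gamma$. A proper $\Gamma$-order ideal $P$ is prime if for $\Gamma$-order ideals $J_1,J_2$, $J_1\cap J_2\subseteq P$ implies $J_1\subseteq P$ or $J_2\subseteq P$. $\operatorname{Spec}_\Gamma(M)$ is the set of prime $\Gamma$-order ideals with the topology whose closed sets are $V(J)=\{P:J\subseteq P\}$, $J$ a $\Gamma$-order ideal. For a $\Gamma$-order ideal $J$, $J^\perp:=\{x\in M:x\parallel a\text{ for all }0\ne a\in J\}\cup\{0\}$ (again a $\Gamma$-order ideal when $M$ is conical refinement); $J$ is regular if $J=(J^{\perp})^\perp$. $\operatorname{RegSpec}_\Gamma(M)$ is the subspace of $\operatorname{Spec}_\Gamma(M)$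 of regular prime $\Gamma$-order ideals. A nonempty $\mathcal F\subseteq M$ is a $\Gamma$-filter if: (F1) $0\notin\mathcal F$ and $\mathcal F$ is closed under $\Gamma$; (F2) $x\in\mathcal F$, $y\ge x$ imply $y\in\mathcal F$; (F3) for $x,y\in\mathcal F$ there are $\alpha,\beta\in\mathbb N[\Gamma]$, $z\in\mathcal F$ with ${}^\alpha x\ge z$ and ${}^\beta y\ge z$. It is prime if $x+y\in\mathcal F$ implies $x\in\mathcal F$ or $y\in\mathcal F$. The set of $\Gamma$-filters has the topology with basis $\mathscr D(J)=\{\mathcal F:J\cap\mathcal F\ne\emptyset\}$, $J$ a $\Gamma$-order ideal; the set $\mathscr{PF}il(M)$ of prime $\Gamma$-filters has the subspace topology. For $\mathcal F\in\mathscr{PF}il(M)$, $J_{\mathcal F}:=M\setminus\mathcal F$ (a prime $\Gamma$-order ideal). For $X\subseteq M$, $\mathcal F(X):=\{x\in M:{}^\gamma x\ge y\text{ for some }\gamma\in\Gamma,\ y\in X\}$. Then $\mathscr{PF}il_r(M):=\{\mathcal F\in\mathscr{PF}il(M):\mathcal F=\mathcal F(J_{\mathcal F}^\perp\setminus\{0\})\}$, with the subspace topology. *)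

(* Defs.v *)
From HB Require Import structures.
From mathcomp Require Import all_boot all_algebra finmap.
From mathcomp Require Import boolp classical_sets functions topology.

Set Implicit Arguments.
Unset Strict Implicit.
Unset Printing Implicit Defensive.

Import GRing.Theory.
Local Open Scope classical_set_scope.
Local Open Scope ring_scope.

(* A Gamma-monoid.  Each [gact g] is a monoid endomorphism; it is an
   automorphism because [gact g^-1] is its inverse. *)
HB.mixin Record isGammaMonoid (Gamma : groupType) M of GRing.Nmodule M := {
  gact : Gamma -> M -> M;
  gact1 : forall x, gact 1%g x = x;
  gactM : forall g h x, gact (g * h)%g x = gact g (gact h x);
  gact0 : forall g, gact g 0 = 0;
  gactD : forall g x y, gact g (x + y) = gact g x + gact g y;
}.

#[short(type="gammaMonoidType")]
HB.structure Definition GammaMonoid (Gamma : groupType) :=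
  {M of isGammaMonoid Gamma M & GRing.Nmodule M}.

Arguments gact {Gamma M} : rename.

Section Monoid.
Context {M : nmodType}.
Implicit Types x y : M.

Definition alg_le x y := exists z, y = x + z.

Definition incomparable x y := ~ alg_le x y /\ ~ alg_le y x.

End Monoid.

Definition conical (M : nmodType) :=
  forall x y : M, x + y = 0 -> x = 0 /\ y = 0.

Definition refinement (M : nmodType) :=
  forall a b c d : M, a + b = c + d ->
    exists z1 z2 z3 z4 : M,
      [/\ a = z1 + z2, b = z3 + z4, c = z1 + z3 & d = z2 + z4].

Section GammaMonoidDefs.
Context {Gamma : groupType} {M : gammaMonoidType Gamma}.
Implicit Types (x y z : M) (J P X F : set M).

(* Elements of N[Gamma] are the finitely supported functions Gamma -> nat. *)
Definition nact (a : {fsfun Gamma -> nat with 0%N}) x : M :=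
  \sum_(g <- finsupp a) gact g x *+ a g.

Record order_ideal J : Prop := OrderIdeal {
  ideal0 : J 0;
  idealD : forall x y, J x -> J y -> J (x + y);
  ideal_le : forall x y, alg_le x y -> J y -> J x;
  ideal_act : forall g x, J x -> J (gact g x);
}.

Definition prime_ideal P :=
  [/\ order_ideal P, P != setT &
    forall J1 J2, order_ideal J1 -> order_ideal J2 ->
      J1 `&` J2 `<=` P -> J1 `<=` P \/ J2 `<=` P].

Definition perp J : set M :=
  [set x | forall a, J a -> a != 0 -> incomparable x a] `|` [set 0].

Definition regular_ideal J := J = perp (perp J).

Record gamma_filter F : Prop := GammaFilter {
  gfilter_neq0 : F !=set0;
  gfilterN0 : ~ F 0;
  gfilter_act : forall g x, F x -> F (gact g x);
  gfilter_le : forall x y, F x -> alg_le x y -> F y;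
  gfilter_meet : forall x y, F x -> F y ->
    exists a b z, [/\ F z, alg_le z (nact a x) & alg_le z (nact b y)];
}.

Definition prime_filter F :=
  gamma_filter F /\ forall x y, F (x + y) -> F x \/ F y.

Definition filter_gen X : set M :=
  [set x | exists g y, X y /\ alg_le y (gact g x)].

(* [~` F] is the ideal J_F. *)
Definition perp_generated F := F = filter_gen (perp (~` F) `\ 0).

Definition ideal_gen X : set M :=
  [set x | forall J, order_ideal J -> X `<=` J -> J x].

Lemma order_idealT : order_ideal [set: M].
Proof. by []. Qed.

Lemma order_idealI J1 J2 :
  order_ideal J1 -> order_ideal J2 -> order_ideal (J1 `&` J2).
Proof.
move=> [a0 aD al aa] [b0 bD bl ba]; split=> //.
- by move=> x y [? ?] [? ?]; split; [exact: aD|exact: bD].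
- by move=> x y xy [? ?]; split; [exact: al xy _|exact: bl xy _].
- by move=> g x [? ?]; split; [exact: aa|exact: ba].
Qed.

Lemma order_ideal_gen X : order_ideal (ideal_gen X).
Proof.
split.
- by move=> J [].
- by move=> x y hx hy J hJ XJ; apply: (idealD hJ); [exact: hx|exact: hy].
- by move=> x y xy hy J hJ XJ; apply: (ideal_le hJ xy); exact: hy.
- by move=> g x hx J hJ XJ; apply: (ideal_act hJ); exact: hx.
Qed.

Lemma sub_ideal_gen X : X `<=` ideal_gen X.
Proof. by move=> x Xx J _; apply. Qed.

Lemma ideal_gen_sub X J : order_ideal J -> X `<=` J -> ideal_gen X `<=` J.
Proof. by move=> hJ XJ x; apply. Qed.

Lemma ideal_nact J a x : order_ideal J -> J x -> J (nact a x).
Proof.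
move=> hJ Jx; rewrite /nact; elim/big_ind: _ => [||g _]; first exact: ideal0.
  exact: idealD.
elim: (a g) => [|n IHn]; first by rewrite mulr0n; exact: ideal0.
by rewrite mulrS; apply: (idealD hJ) => //; exact: ideal_act.
Qed.

End GammaMonoidDefs.

Record Spec (Gamma : groupType) (M : gammaMonoidType Gamma) := MkSpec {
  spec_val :> set M;
  spec_prime : prime_ideal spec_val;
}.

Record GFilter (Gamma : groupType) (M : gammaMonoidType Gamma) := MkGFilter {
  gfilter_val :> set M;
  gfilterP : gamma_filter gfilter_val;
}.

Section Topologies.
Context (Gamma : groupType) (M : gammaMonoidType Gamma).

Definition specV (J : set M) : set (Spec M) := [set P | J `<=` P].

Definition filterD (J : set M) : set (GFilter M) :=
  [set F | J `&` F !=set0].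

Definition spec_open (U : set (Spec M)) :=
  exists2 J : set M, order_ideal J & U = ~` specV J.

Let spec_openT : spec_open setT.
Proof.
exists setT; first exact: order_idealT.
apply/esym/seteqP; split=> // P _ TP; have [_ /eqP + _] := spec_prime P.
by apply; apply/seteqP; split.
Qed.

Let spec_openI : setI_closed spec_open.
Proof.
move=> _ _ [J1 i1 ->] [J2 i2 ->]; exists (J1 `&` J2); first exact: order_idealI.
rewrite -setCU; congr (~` _); apply/seteqP; split=> P.
  by move=> [h x [/h]|h x [_ /h]].
by have [_ _ pr] := spec_prime P; exact: pr.
Qed.

Let spec_open_bigU (I : Type) (f : I -> set (Spec M)) :
  (forall i, spec_open (f i)) -> spec_open (\bigcup_i f i).
Proof.
move=> fop; pose Js J := order_ideal J /\ exists i, f i = ~` specV J.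
exists (ideal_gen (\bigcup_(J in Js) J)); first exact: order_ideal_gen.
apply/seteqP; split=> P.
  move=> [i _ fiP]; have [J iJ fE] := fop i.
  move=> h; move: fiP; rewrite fE; apply=> x Jx; apply: h; apply: sub_ideal_gen.
  by exists J => //; split=> //; exists i.
move=> nP; apply: contrapT => nU; apply: nP; have [iP _ _] := spec_prime P.
apply: ideal_gen_sub => // x [J [iJ [i fE]] Jx]; apply: contrapT => nPx.
by apply: nU; exists i => //; rewrite fE => /(_ x Jx).
Qed.

HB.instance Definition _ := gen_eqMixin (Spec M).
HB.instance Definition _ := gen_choiceMixin (Spec M).
HB.instance Definition _ :=
  isOpenTopological.Build (Spec M) spec_openT spec_openI spec_open_bigU.

HB.instance Definition _ := gen_eqMixin (GFilter M).
HB.instance Definition _ := gen_choiceMixin (GFilter M).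

Let filterD_cover :
  \bigcup_(J in [set J : set M | order_ideal J]) filterD J = setT.
Proof.
apply/seteqP; split=> // F _; exists setT; first exact: order_idealT.
by rewrite /filterD /= setTI; exact: gfilter_neq0 (gfilterP F).
Qed.

Let filterD_join (J1 J2 : set M) (F : GFilter M) :
  order_ideal J1 -> order_ideal J2 -> filterD J1 F -> filterD J2 F ->
  exists K, [/\ order_ideal K, filterD K F
    & filterD K `<=` filterD J1 `&` filterD J2].
Proof.
move=> i1 i2 [x [J1x Fx]] [y [J2y Fy]].
have [a [b [z [Fz zx zy]]]] := gfilter_meet (gfilterP F) Fx Fy.
exists (J1 `&` J2); split; first exact: order_idealI.
  exists z; split=> //; split.
    by apply: (ideal_le i1 zx); exact: ideal_nact.
  by apply: (ideal_le i2 zy); exact: ideal_nact.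
by move=> G [t [[J1t J2t] Gt]]; split; exists t.
Qed.

HB.instance Definition _ :=
  isBaseTopological.Build (GFilter M) filterD_cover filterD_join.

Lemma closed_SpecE (A : set (Spec M)) :
  closed A <-> exists2 J : set M, order_ideal J & A = specV J.
Proof.
rewrite -openC; split=> -[J iJ].
  by move=> /(congr1 setC); rewrite !setCK; exists J.
by move=> ->; exists J.
Qed.

Lemma open_GFilterE (U : set (GFilter M)) :
  open U <-> exists2 D : set (set M), D `<=` [set J | order_ideal J]
    & \bigcup_(J in D) filterD J = U.
Proof. by []. Qed.

Definition RegSpec : set (Spec M) := [set P | regular_ideal (P : set M)].

Definition PFil : set (GFilter M) := [set F | prime_filter (F : set M)].

Definition PFil_r : set PFil :=
  [set F | perp_generated ((set_val F : GFilter M) : set M)].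

End Topologies.

Arguments RegSpec {Gamma} M.
Arguments PFil {Gamma} M.
Arguments PFil_r {Gamma} M.

(* A set [A : set X] used as a type is [set_type A], whose canonical topology
   is the subspace topology (initial for [set_val]). *)
Definition homeomorphic (X Y : topologicalType) :=
  exists (f : X -> Y) (g : Y -> X),
    [/\ cancel f g, cancel g f, continuous f & continuous g].

(* Main.v *)
Require Import Defs.
From mathcomp Require Import all_boot all_algebra.
From mathcomp Require Import boolp classical_sets functions topology.
From mathcomp Require Import finmap.

(** Complementation exchanges prime ideals and prime filters: the ideal
generated by [x] consists of the elements below some N[Gamma]-multiple of [x],
so primeness of an ideal is axiom (F3) for its complement.  For a down-set [J],
an element lies in [perp J] iff it has no nonzero element of [J] below it;
hence [P = perp (perp P)] says that the elements outside [P] are exactly those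
above a nonzero element of [perp P].  Finally, [P] misses part of an ideal [J]
iff its complement meets [J], so the two topologies correspond. *)

Set Implicit Arguments.
Unset Strict Implicit.
Unset Printing Implicit Defensive.

Import GRing.Theory.
Local Open Scope classical_set_scope.
Local Open Scope ring_scope.

(** * The algebraic preorder *)

Section AlgebraicPreorder.
Context {M : nmodType}.
Implicit Types x y z : M.

Lemma alg_le_refl x : alg_le x x.
Proof. by exists 0; rewrite addr0. Qed.

Lemma alg_le_trans y x z : alg_le x y -> alg_le y z -> alg_le x z.
Proof. by move=> [u ->] [v ->]; exists (u + v); rewrite addrA. Qed.

Lemma alg_leD x y x' y' :
  alg_le x y -> alg_le x' y' -> alg_le (x + x') (y + y').
Proof. by move=> [u ->] [v ->]; exists (u + v); rewrite addrACA. Qed.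

Lemma alg_le0 x : conical M -> alg_le x 0 -> x = 0.
Proof. by move=> cM [z /esym /cM []]. Qed.

End AlgebraicPreorder.

(** * Prime ideals and prime filters *)

Section IdealsAndFilters.
Context {Gamma : groupType} {M : gammaMonoidType Gamma}.
Implicit Types (x y z : M) (J P F : set M) (s : seq Gamma).

Lemma alg_le_gact (g : Gamma) x y : alg_le x y -> alg_le (gact g x) (gact g y).
Proof. by move=> [z ->]; exists (gact g z); rewrite gactD. Qed.

Lemma gactK (g : Gamma) : cancel (@gact Gamma M g) (gact g^-1%g).
Proof. by move=> x; rewrite -gactM mulVg gact1. Qed.

Lemma gactVK (g : Gamma) : cancel (@gact Gamma M g^-1%g) (gact g).
Proof. by move=> x; rewrite -gactM mulgV gact1. Qed.

Lemma gact_eq0 (g : Gamma) x : gact g x = 0 -> x = 0.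
Proof. by move=> gx0; rewrite -(gactK g x) gx0 gact0. Qed.

(** A list over [Gamma] stands for the element of N[Gamma] whose coefficients are the multiplicities
    in the list. Lists are easier to concatenate and translate than finitely supported functions. *)
Lemma sum_gact_nact s x : exists a, \sum_(g <- s) gact g x = nact a x.
Proof.
pose a : {fsfun Gamma -> nat with 0%N} :=
  [fsfun g in [fset g in s]%fset => count_mem g s].
have aE g : a g = count_mem g s.
  by rewrite fsfunE in_fset /=; case: ifPn => // /count_memPn ->.
have sa : perm_eq (finsupp a) (undup s).
  apply: uniq_perm; [exact: fset_uniq|exact: undup_uniq|move=> g].
  by rewrite mem_finsupp aE mem_undup -has_pred1 has_count lt0n.
exists a; rewrite /nact (perm_big _ sa) /= -big_undup_iterop_count /=.
by apply: eq_bigr => g _; rewrite aE Monoid.iteropE -iter_addr_0.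
Qed.

(** Concatenating lists gives closure under addition, and left translation of a list gives closure
    under [Gamma]. *)
Lemma order_ideal_principal x :
  order_ideal [set t | exists s, alg_le t (\sum_(g <- s) gact g x)].
Proof.
split=> /=.
- by exists [::]; rewrite big_nil; exact: alg_le_refl.
- move=> y z [s ys] [t zt]; exists (s ++ t); rewrite big_cat /=.
  exact: alg_leD.
- by move=> y z yz [s zs]; exists s; exact: alg_le_trans zs.
- move=> g y [s ys]; exists [seq (g * h)%g | h <- s].
  rewrite big_map; under eq_bigr do rewrite gactM.
  by rewrite -(big_morph _ (gactD g) (gact0 g)); exact: alg_le_gact.
Qed.

Lemma ideal_actV J (g : Gamma) x : order_ideal J -> J (gact g x) -> J x.
Proof. by move=> iJ /(ideal_act iJ g^-1%g); rewrite gactK. Qed.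

Lemma prime_filter_setC P : prime_ideal P -> prime_filter (~` P).
Proof.
move=> [iP /eqP PnT prP]; split; last first.
  move=> x y; apply: contra_notP => /not_orP[/contrapT Px /contrapT Py].
  exact: idealD.
split.
- by apply/set0P/eqP => /(congr1 setC); rewrite setCK setC0.
- by apply; exact: ideal0.
- by move=> g x Px; apply: contra_not Px => /(ideal_actV iP).
- by move=> x y Px xy; apply: contra_not Px => /(ideal_le iP xy).
move=> x y Px Py.
(* Such a [z] is a witness for (F3). If there is none, the principal ideals of [x] and [y] meet
   inside [P], and primeness puts [x] or [y] in [P]. *)
have [] := pselect (exists z, [/\ ~ P z,
  exists s, alg_le z (\sum_(g <- s) gact g x) &
  exists s, alg_le z (\sum_(g <- s) gact g y)]).
  move=> [z [Pz [s zx] [t zy]]].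
  have [a xa] := sum_gact_nact s x; have [b yb] := sum_gact_nact t y.
  by exists a, b, z; rewrite -xa -yb.
have mem1 (u : M) : exists s, alg_le u (\sum_(g <- s) gact g u).
  by exists [:: 1%g]; rewrite big_seq1 gact1; exact: alg_le_refl.
move=> nz; have [] := prP _ _ (order_ideal_principal x) (order_ideal_principal y).
- by move=> z [zx zy]; apply: contrapT => Pz; apply: nz; exists z.
- by move=> /(_ x (mem1 x)).
- by move=> /(_ y (mem1 y)).
Qed.

Lemma prime_ideal_setC F : prime_filter F -> prime_ideal (~` F).
Proof.
move=> [fF prF]; split.
- split=> [|x y Fx Fy|x y xy|g x].
  + exact: gfilterN0.
  + by move=> /prF[].
  + by apply: contra_not => Fx; exact: gfilter_le xy.
  + by apply: contra_not => /(gfilter_act fF g^-1%g); rewrite gactK.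
- have [x Fx] := gfilter_neq0 fF.
  by apply/eqP => FT; suff: (~` F) x by []; rewrite FT.
move=> J1 J2 i1 i2 J12; apply: contrapT.
move=> /not_orP[/existsNP[x /not_implyP[J1x /contrapT Fx]]].
move=> /existsNP[y /not_implyP[J2y /contrapT Fy]].
(* By (F3), [z] lies in both ideals and in [F], against the inclusion of their intersection in the
   complement. *)
have [a [b [z [Fz zx zy]]]] := gfilter_meet fF Fx Fy.
apply: J12 Fz; split; [apply: ideal_le zx _ | apply: ideal_le zy _] => //;
  exact: ideal_nact.
Qed.

(** * Perpendiculars and regularity *)

Hypothesis Mconical : conical M.

(** If [x] is below an element of the down-set [J], then [x] itself is in [J] and below [x], so one
    direction of comparison suffices. The form for down-sets applies to [perp J] too, through
    [perp_le]. *)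
Lemma perpP J x : (forall y z, alg_le y z -> J z -> J y) ->
  perp J x <-> forall y, J y -> alg_le y x -> y = 0.
Proof.
move=> Jle; split=> [[Jx y Jy yx|-> y _]|Jx]; last 2 first.
- exact: alg_le0.
- have [->|/eqP x0] := eqVneq x 0; [by right|left=> a Ja /eqP a0].
  split=> [xa|ax]; last by apply: a0; exact: Jx ax.
  by apply: x0; apply: Jx (alg_le_refl x); exact: Jle Ja.
apply: contrapT => /eqP y0; have [_] := Jx _ Jy y0; exact.
Qed.

Lemma perp_le J x y : (forall y z, alg_le y z -> J z -> J y) ->
  alg_le x y -> perp J y -> perp J x.
Proof.
move=> Jle xy /(perpP _ Jle) Jy; apply/(perpP _ Jle) => z Jz zx.
by apply: Jy => //; exact: alg_le_trans xy.
Qed.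

Lemma perp_act J (g : Gamma) x : order_ideal J -> perp J x -> perp J (gact g x).
Proof.
move=> iJ; have Jle := ideal_le iJ.
move=> /(perpP _ Jle) Jx; apply/(perpP _ Jle) => z Jz zx.
apply: (@gact_eq0 g^-1%g); apply: Jx; first exact: ideal_act.
by rewrite -(gactK g x); exact: alg_le_gact.
Qed.

Lemma perp_perpP J x : order_ideal J ->
  perp (perp J) x <-> forall y, perp J y -> alg_le y x -> y = 0.
Proof. by move=> iJ; apply: perpP => y z; apply: perp_le; exact: ideal_le. Qed.

Lemma perpI_eq0 J x : order_ideal J -> J x -> perp J x -> x = 0.
Proof.
by move=> iJ Jx /(perpP _ (ideal_le iJ)); apply => //; exact: alg_le_refl.
Qed.

Lemma regular_idealP P : order_ideal P ->
  regular_ideal P <-> perp_generated (~` P).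
Proof.
rewrite /perp_generated setCK => iP; split=> [regP|genP].
  apply/seteqP; split=> [x Px|x [g [y [[Py y0] yx]]] Px].
    (* If no nonzero element of [perp P] were below [x], then [x] would lie in [perp (perp P)],
       which is [P]. *)
    apply: contrapT => nx; apply: Px; rewrite regP; apply/perp_perpP => // y Py.
    move=> yx; apply: contrapT => y0; apply: nx; exists 1%g, y.
    by rewrite gact1.
  apply: y0; apply: perpI_eq0 Py => //; apply: ideal_le yx _ => //.
  exact: ideal_act.
apply/seteqP; split=> x.
  move=> Px; apply/perp_perpP => // y Py yx; apply: perpI_eq0 Py => //.
  exact: ideal_le yx _.
move=> /(perp_perpP _ iP) PPx; apply: contrapT => nPx.
have : (~` P) x by [].
rewrite genP => -[g [y [[Py y0] yx]]]; apply: y0.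
(* The translate of [y] by the inverse of [g] is in [perp P] and below [x], so it vanishes. *)
apply: (@gact_eq0 g^-1%g); apply: PPx; first exact: perp_act.
by rewrite -(gactK g x); exact: alg_le_gact.
Qed.

End IdealsAndFilters.

Lemma Spec_inj (Gamma : groupType) (M : gammaMonoidType Gamma) (P Q : Spec M) :
  P = Q :> set M -> P = Q.
Proof.
by case: P Q => [P pP] [Q pQ] /= PQ; subst Q; congr MkSpec; exact: Prop_irrelevance.
Qed.

Lemma GFilter_inj (Gamma : groupType) (M : gammaMonoidType Gamma)
  (F G : GFilter M) : F = G :> set M -> F = G.
Proof.
by case: F G => [F fF] [G fG] /= FG; subst G; congr MkGFilter; exact: Prop_irrelevance.
Qed.

(** * Complementation as a homeomorphism *)

Section Homeomorphism.
Context {Gamma : groupType} {M : gammaMonoidType Gamma}.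
Hypothesis Mconical : conical M.

Definition setC_filter (P : Spec M) : GFilter M :=
  MkGFilter (prime_filter_setC (spec_prime P)).1.

Definition setC_PFil (P : Spec M) : PFil M :=
  exist _ (setC_filter P) (mem_set (prime_filter_setC (spec_prime P))).

Lemma PFil_r_setC (P : RegSpec M) : PFil_r M (setC_PFil (set_val P)).
Proof.
by have [iP _ _] := spec_prime (set_val P); apply/regular_idealP => //;
  exact: (set_mem (valP P)).
Qed.

Definition filter_of_ideal (P : RegSpec M) : PFil_r M :=
  exist _ (setC_PFil (set_val P)) (mem_set (PFil_r_setC P)).

Definition setC_spec (F : PFil M) : Spec M :=
  MkSpec (prime_ideal_setC (set_mem (valP F))).

Lemma RegSpec_setC (F : PFil_r M) : RegSpec M (setC_spec (set_val F)).
Proof.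
have [iF _ _] := spec_prime (setC_spec (set_val F)).
by apply/regular_idealP => //=; rewrite setCK; exact: (set_mem (valP F)).
Qed.

Definition ideal_of_filter (F : PFil_r M) : RegSpec M :=
  exist _ (setC_spec (set_val F)) (mem_set (RegSpec_setC F)).

Lemma filter_of_idealK : cancel filter_of_ideal ideal_of_filter.
Proof. by move=> P; apply: val_inj; apply: Spec_inj; exact: setCK. Qed.

Lemma ideal_of_filterK : cancel ideal_of_filter filter_of_ideal.
Proof.
by move=> F; do 2 apply: val_inj; apply: GFilter_inj; exact: setCK.
Qed.

Lemma continuous_filter_of_ideal : continuous filter_of_ideal.
Proof.
(* [PFil_r M] is a subspace of the subspace [PFil M], so continuity is tested after two
   inclusions. *)
do 2 apply: continuous_comp_initial.
apply/continuousP => _ /open_GFilterE[D iD <-].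
rewrite preimage_bigcup; apply: bigcup_open => J /iD iJ.
have -> : (set_val \o (set_val \o filter_of_ideal)) @^-1` (filterD J) =
    (set_val : RegSpec M -> Spec M) @^-1` (~` specV J).
  apply/seteqP; split=> P /=; first by move=> [x [Jx nPx]] /(_ x Jx).
  by move=> /existsNP[x /not_implyP[Jx nPx]]; exists x.
apply: open_comp; last by exists J.
by move=> P _; exact: initial_continuous.
Qed.

Lemma continuous_ideal_of_filter : continuous ideal_of_filter.
Proof.
apply: continuous_comp_initial.
apply/continuousP => _ [J iJ ->].
have -> : (set_val \o ideal_of_filter) @^-1` (~` specV J) =
    (fun F : PFil_r M => set_val (set_val F)) @^-1` (filterD J).
  apply/seteqP; split=> F /=.
    by move=> /existsNP[x /not_implyP[Jx /contrapT Fx]]; exists x.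
  by move=> [x [Jx Fx]] /(_ x Jx).
apply: open_comp.
  move=> F _; apply: continuous_comp; exact: initial_continuous.
(* A basic set is open as the union of a one-member family. *)
apply/open_GFilterE; exists [set J]; first by move=> _ ->.
by rewrite bigcup_set1.
Qed.

End Homeomorphism.

Theorem corollary4p6 (Gamma : groupType) (M : gammaMonoidType Gamma)
  (Mconical : conical M) (Mrefinement : refinement M) :
  homeomorphic (RegSpec M) (PFil_r M).
Proof.
exists (filter_of_ideal Mconical), (ideal_of_filter Mconical); split.
- exact: filter_of_idealK.
- exact: ideal_of_filterK.
- exact: continuous_filter_of_ideal.
- exact: continuous_ideal_of_filter.
Qed.
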